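(* Let $\alpha\in(0,1)$. For every $\delta>0$ there exists $N$ such that for all $n\ge N$ there is a network $G=G_{n,\epsilon}$ of $n$ firms, with input-output linkage matrix $W=W_{n,\epsilon}$ parameterized by a variable $\epsilon\in(0,1)$, with the following properties. (1) As $\epsilon\to0$ and $n\to\infty$, the first coordinate of the influence vector $v_{W_{n,\epsilon}}$ approaches $\frac{1-\alpha}{2-\alpha}$ and all other coordinates approach $0$ (i.e. the maximum of the other coordinates tends to $0$). (2) There exists a scenario in which data is missing for at most a $\delta$ share of the firms of $G_{n,\epsilon}$ such that, for the resulting observed network $G'_{n,\epsilon}$ with observed linkage matrix $U_{n,\epsilon}$, as $\epsilon\to0$ and $n\to\infty$ the second coordinate of the influence vector $v_{U_{n,\epsilon}}$ approaches $\frac{1-\alpha}{2-\alpha}$ and all other coordinates approach $0$ (i.e. the maximum of the other coordinates tends to $0$).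
   Context: An input-output linkage matrix of $n$ firms is a real $n\times n$ matrix $W=(w_{ij})$ with $w_{ij}\ge 0$, $w_{ii}=0$ and $\sum_{j=1}^n w_{ij}=1$ for all $i$; $w_{ij}$ is the share of the intermediate inputs of firm $i$ that come from firm $j$. With $W'$ the transpose of $W$ and $\vec{\mathbf 1}$ the all-ones column vector, the influence vector of $W$ (for the parameter $\alpha$) is $v_W=\frac{\alpha}{n}(I-(1-\alpha)W')^{-1}\vec{\mathbf 1}$ (the inverse exists). Missing data: firm $i$ has total intermediate input use $\mathrm{II}_i>0$, of which $w_{ij}\mathrm{II}_i$ comes from firm $j$. Only amounts $x_{ij}$ with $0\le x_{ij}\le w_{ij}\mathrm{II}_i$ and $\sum_k x_{ik}>0$ are observed; the rest is missing. The observed network has the same $n$ firms and linkage matrix $U=(u_{ij})$ with $u_{ij}=x_{ij}/\sum_k x_{ik}$. ''Data is missing for at most a $\delta$ share of the firms'' means that there is a set $S$ of at most $\delta n$ firms such that the only missing data concerns contributions of firms in $S$ to other firms, i.e. $x_{ij}=w_{ij}\mathrm{II}_i$ for all $i$ and all $j\notin S$. *)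

(* Defs.v *)
From HB Require Import structures.
From mathcomp Require Import all_boot all_order all_algebra.
From mathcomp Require Import all_classical all_reals all_analysis.

Set Implicit Arguments.
Unset Strict Implicit.
Unset Printing Implicit Defensive.

Import Order.TTheory GRing.Theory Num.Theory.
Import numFieldNormedType.Exports.

Local Open Scope classical_set_scope.
Local Open Scope ring_scope.

Definition is_linkage (R : realType) (n : nat) (W : 'M[R]_n) : Prop :=
  [/\ forall i j, 0 <= W i j,
      forall i, W i i = 0
    & forall i, \sum_j W i j = 1].

Definition influence (R : realType) (alpha : R) (n : nat) (W : 'M[R]_n)
    : 'cV[R]_n :=
  (alpha / n%:R) *: (invmx (1%:M - (1 - alpha) *: W^T) *m const_mx 1).

(* [x i j] is the amount of firm [i]'s inputs observed to come from firm [j];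
   [II i] is the total intermediate input use of firm [i]. *)
Definition is_observation (R : realType) (n : nat) (W : 'M[R]_n)
    (II : 'I_n -> R) (x : 'M[R]_n) : Prop :=
  (forall i j, 0 <= x i j <= W i j * II i) /\ (forall i, 0 < \sum_k x i k).

Definition observed_linkage (R : realType) (n : nat) (x : 'M[R]_n) : 'M[R]_n :=
  \matrix_(i, j) (x i j / \sum_k x i k).

Definition missing_share_le (R : realType) (delta : R) (n : nat) (W : 'M[R]_n)
    (II : 'I_n -> R) (x : 'M[R]_n) : Prop :=
  exists2 S : {set 'I_n}, #|S|%:R <= delta * n%:R
    & forall i j, j \notin S -> x i j = W i j * II i.

(* Coordinates are numbered from 0; the default value is used only when the
   vector has no coordinate [k]. *)
Definition coord_at (R : realType) (n : nat) (v : 'cV[R]_n) (k : nat) : R :=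
  if insub k is Some i then v i ord0 else 0.

(* Influence vectors are entrywise nonnegative, so for them this is the plain
   maximum of the coordinates other than the [k]-th. *)
Definition max_other (R : realType) (n : nat) (v : 'cV[R]_n) (k : nat) : R :=
  \big[Num.max/0]_(i < n | val i != k) `|v i ord0|.

(* The limit "as eps -> 0 and n -> oo" is the joint one, along the product of
   the filters [\oo] and [0^'+]. *)
Definition concentrates_at (R : realType) (v : forall n : nat, R -> 'cV[R]_n)
    (k : nat) (c : R) : Prop :=
  (coord_at (v p.1 p.2) k @[p --> (\oo, (0 : R)^'+)] --> c) /\
  (max_other (v p.1 p.2) k @[p --> (\oo, (0 : R)^'+)] --> (0 : R)).

(* Main.v *)
Require Import Defs.
From HB Require Import structures.
From mathcomp Require Import all_boot all_order all_algebra.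
From mathcomp Require Import all_classical all_reals all_analysis.
From mathcomp Require Import zify ring lra.

Set Implicit Arguments.
Unset Strict Implicit.
Unset Printing Implicit Defensive.

Import Order.TTheory GRing.Theory Num.Theory.
Import numFieldNormedType.Exports.

Local Open Scope classical_set_scope.
Local Open Scope ring_scope.


(** An influence vector has total weight 1 and satisfies
    [v_j = alpha/n + (1-alpha) * sum_i w_ij v_i], so a firm from which everybody
    buys little has little influence, while a hub [k] from which essentially all
    firms buy has [v_k] close to the solution [(1-alpha)/(2-alpha)] of
    [t = (1-alpha)(1-t)].  Let firm 0 supply a share [1-eps] of the inputs of
    every other firm, firm 1 supply the share [eps] left to firms [2, ..., n-1],
    and spread everything else evenly over firms [2, ..., n-1].  Firm 0 is the
    hub.  If only the deliveries of firm 0 go missing, which is a share [1/n] of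
    the firms, normalization turns [eps] into [1] and the hub is firm 1. *)

(** * Influence vectors: existence, total weight and estimates at a hub *)

Section Influence.
Variables (R : realType) (alpha : R) (n : nat) (W : 'M[R]_n).
Hypotheses (halpha : 0 < alpha < 1) (W_linkage : is_linkage W).

(** A row vector [u] in the kernel satisfies [u = (1 - alpha) u W^T]. At an index where [|u|] is
    maximal, row sums 1 of [W] make the maximum at most [1 - alpha] times itself, hence 0. *)
Lemma influence_unitmx : 1%:M - (1 - alpha) *: W^T \in unitmx.
Proof.
have [a0 a1] := andP halpha; have [W0 _ W1] := W_linkage.
rewrite -row_free_unit -kermx_eq0; apply/rowV0P => u /sub_kermxP.
rewrite mulmxBr mulmx1 => /eqP; rewrite subr_eq0 => /eqP uE.
apply/rowP => i0; rewrite mxE; apply/eqP; rewrite -normr_le0.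
pose i := [arg max_(i > i0) `|u ord0 i|]%O.
have imax j : `|u ord0 j| <= `|u ord0 i|.
  by rewrite /i; case: arg_maxP => // k _; apply.
apply: le_trans (imax i0) _.
suff: `|u ord0 i| <= (1 - alpha) * `|u ord0 i| by nra.
rewrite {1}uE -scalemxAr !mxE normrM ger0_norm; last lra.
apply: ler_wpM2l; first lra.
apply: le_trans (ler_norm_sum _ _ _) _.
rewrite -[leRHS]mul1r -(W1 i) mulr_suml; apply: ler_sum => j _.
by rewrite !mxE normrM mulrC ger0_norm //; apply: ler_wpM2l.
Qed.

Let v := influence alpha W.

Lemma influenceE j :
  v j ord0 = alpha / n%:R + (1 - alpha) * \sum_i W i j * v i ord0.
Proof.
have: (1%:M - (1 - alpha) *: W^T) *m v = (alpha / n%:R) *: const_mx 1.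
  by rewrite /v /influence -scalemxAr mulKVmx ?influence_unitmx.
rewrite mulmxBl mul1mx -scalemxAl => /matrixP/(_ j ord0); rewrite !mxE mulr1.
move=> /eqP; rewrite subr_eq => /eqP ->; congr (_ + _ * _).
by apply: eq_bigr => i _; rewrite mxE.
Qed.

Lemma sum_linkage (f : 'I_n -> R) : \sum_j \sum_i W i j * f i = \sum_i f i.
Proof.
have [_ _ W1] := W_linkage.
by rewrite exchange_big; apply: eq_bigr => i _; rewrite -mulr_suml W1 mul1r.
Qed.

Hypothesis n_gt0 : (0 < n)%N.

Lemma sum_alphaDn : \sum_(j < n) alpha / n%:R = alpha.
Proof.
by rewrite sumr_const card_ord -[LHS]mulr_natr divfK // pnatr_eq0 -lt0n.
Qed.

(** Summing [influenceE] over [j] shows that the total [s] solves [s = alpha + (1 - alpha) s]. *)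
Lemma sum_influence : \sum_j v j ord0 = 1.
Proof.
have [a0 a1] := andP halpha.
have: \sum_j v j ord0 = alpha + (1 - alpha) * \sum_j v j ord0.
  rewrite {1}(eq_bigr _ (fun j _ => influenceE j)).
  rewrite big_split /= sum_alphaDn -mulr_sumr.
  by rewrite (sum_linkage (fun i => v i ord0)).
by move=> vE; apply: (@mulfI _ alpha); lra.
Qed.

Lemma norm_influence_le j :
  `|v j ord0| <= alpha / n%:R + (1 - alpha) * \sum_i W i j * `|v i ord0|.
Proof.
have [a0 a1] := andP halpha; have [W0 _ _] := W_linkage.
rewrite influenceE; apply: le_trans (ler_normD _ _) _.
apply: lerD; first by rewrite ger0_norm // divr_ge0 // ltW.
rewrite normrM ger0_norm; last lra.
apply: ler_wpM2l; first lra.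
apply: le_trans (ler_norm_sum _ _ _) _; apply: ler_sum => i _.
by rewrite normrM ger0_norm.
Qed.

(** The summation behind [sum_influence], done with absolute values; it serves below in place of the
    nonnegativity of [v]. *)
Lemma sum_norm_influence : \sum_j `|v j ord0| <= 1.
Proof.
have [a0 a1] := andP halpha.
have: \sum_j `|v j ord0| <= alpha + (1 - alpha) * \sum_j `|v j ord0|.
  apply: le_trans (ler_sum _ (fun j _ => norm_influence_le j)) _.
  rewrite big_split /= sum_alphaDn -mulr_sumr.
  by rewrite (sum_linkage (fun i => `|v i ord0|)).
by nra.
Qed.

(** A firm that supplies each firm with a share of at most [eta] receives at most [eta] times the
    total weight, on top of [alpha / n]. *)
Lemma norm_influence_small (eta : R) j :
    (forall i, W i j <= eta) ->
  `|v j ord0| <= n%:R^-1 + eta.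
Proof.
move=> Weta; have [a0 a1] := andP halpha; have [W0 _ _] := W_linkage.
have eta0 : 0 <= eta by apply: le_trans (Weta j).
have nV : 0 <= n%:R^-1 :> R by rewrite invr_ge0.
have sle : \sum_i W i j * `|v i ord0| <= eta.
  rewrite -[leRHS]mulr1; apply: (@le_trans _ _ (eta * \sum_i `|v i ord0|)).
    by rewrite mulr_sumr; apply: ler_sum => i _; exact: ler_wpM2r.
  exact: ler_wpM2l sum_norm_influence.
by apply: le_trans (norm_influence_le j) _; nra.
Qed.

(* [z] is a possible exception: it need not buy from the hub [k], but nobody
   other than [k] can carry much weight. Hence [v k] nearly solves
   [t = (1 - alpha) * (1 - t)]. *)
Lemma influence_hub (eta : R) (k z : 'I_n) :
    0 <= eta ->
    (forall i j, j != k -> W i j <= eta) ->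
    (forall i, i != k -> i != z -> 1 - eta <= W i k) ->
  `|v k ord0 - (1 - alpha) / (2 - alpha)| <= 2 * (n%:R^-1 + eta).
Proof.
move=> eta0 Weta Whub.
have [a0 a1] := andP halpha; have [W0 Wd W1] := W_linkage.
have Wle1 i j : W i j <= 1.
  by rewrite -(W1 i) (bigD1 j) //= lerDl sumr_ge0.
have nV : 0 <= n%:R^-1 :> R by rewrite invr_ge0.
(* [D] is the weight that firms other than [k] pass on to suppliers other than [k]. *)
pose D := \sum_(i | i != k) (1 - W i k) * v i ord0.
have vkE : v k ord0 = alpha / n%:R + (1 - alpha) * (1 - v k ord0 - D).
  rewrite {1}influenceE; congr (_ + _ * _).
  rewrite -[X in X - _ - _]sum_influence [X in X - _ - _](bigD1 k) //=.
  rewrite [X in X - _]addrAC subrr add0r (bigD1 k) //= Wd mul0r add0r -sumrB.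
  apply: eq_bigr => i _.
  by rewrite mulrBl mul1r subKr.
(* If [z] differs from [k], its term is at most [|v z|], which is small since [z] is no hub; all
   other terms together are at most [eta] times the total weight. *)
have Dle : `|D| <= n%:R^-1 + 2 * eta.
  have [zk|zk] := eqVneq z k.
    suff : `|D| <= eta by lra.
    apply: le_trans (ler_norm_sum _ _ _) _.
    apply: (@le_trans _ _ (eta * \sum_i `|v i ord0|)); last first.
      rewrite -[leRHS]mulr1; exact: ler_wpM2l sum_norm_influence.
    rewrite mulr_sumr [leRHS](bigD1 k) //= -[leLHS]add0r; apply: lerD.
      exact: mulr_ge0.
    apply: ler_sum => i ik; rewrite normrM; apply: ler_wpM2r => //.
    rewrite ger0_norm ?subr_ge0 //.
    by have := Whub _ ik; rewrite zk => /(_ ik); lra.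
  rewrite /D (bigD1 z) //=; apply: le_trans (ler_normD _ _) _.
  have -> : n%:R^-1 + 2 * eta = (n%:R^-1 + eta) + eta by ring.
  apply: lerD.
    apply: le_trans (norm_influence_small (fun i => Weta i z zk)).
    rewrite normrM -[leRHS]mul1r; apply: ler_wpM2r => //.
    rewrite ger0_norm ?subr_ge0 //; have := W0 z k; lra.
  apply: le_trans (ler_norm_sum _ _ _) _.
  apply: (@le_trans _ _ (eta * \sum_i `|v i ord0|)); last first.
    rewrite -[leRHS]mulr1; exact: ler_wpM2l sum_norm_influence.
  rewrite mulr_sumr [leRHS](bigID (fun i => (i != k) && (i != z))) /=.
  rewrite -[leLHS]addr0; apply: lerD; last first.
    by apply: sumr_ge0 => i _; exact: mulr_ge0.
  apply: ler_sum => i /andP[ik iz]; rewrite normrM; apply: ler_wpM2r => //.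
  rewrite ger0_norm ?subr_ge0 //.
  by have := Whub _ ik iz; lra.
(* This solves the linear equation [vkE] for [v k]. The divisor [2 - alpha] exceeds 1, so it can
   only shrink the error. *)
have -> : v k ord0 - (1 - alpha) / (2 - alpha) =
    (alpha / n%:R - (1 - alpha) * D) / (2 - alpha).
  have -> : v k ord0 = (v k ord0 * (2 - alpha)) / (2 - alpha).
    by rewrite mulfK //; lra.
  rewrite -mulrBl; congr (_ / _); lra.
rewrite normrM [X in _ * X]ger0_norm ?invr_ge0; last lra.
rewrite ler_pdivrMr; last lra.
apply: le_trans (ler_normB _ _) _.
rewrite !normrM (ger0_norm nV) (ger0_norm (ltW a0)).
rewrite (@ger0_norm _ (1 - alpha)); last lra.
have DleM : (1 - alpha) * `|D| <= `|D| by rewrite ler_piMl //; lra.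
have nVM : alpha * n%:R^-1 <= n%:R^-1 :> R by rewrite ler_piMl // ltW.
suff : 2 * (n%:R^-1 + eta) <= 2 * (n%:R^-1 + eta) * (2 - alpha) by lra.
by rewrite ler_peMr; lra.
Qed.

End Influence.

(** * From explicit error bounds to the joint limit *)

Section Concentration.
Variables (R : realType) (alpha : R) (halpha : 0 < alpha < 1).

Lemma concentrates_at_bound (v : forall n : nat, R -> 'cV[R]_n) (k : nat)
    (c C : R) : 0 < C ->
    (forall n eps, (2 < n)%N -> 0 < eps < 1 ->
      `|coord_at (v n eps) k - c| <= C * (n%:R^-1 + eps) /\
      max_other (v n eps) k <= C * (n%:R^-1 + eps)) ->
  concentrates_at v k c.
Proof.
move=> C0 vle.
have near1 (P : set nat) : (\forall n \near \oo, P n) ->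
    \forall p \near (\oo, (0 : R)^'+), P p.1 by exact: cvg_fst.
have near2 (P : set R) : (\forall x \near (0 : R)^'+, P x) ->
    \forall p \near (\oo, (0 : R)^'+), P p.2 by exact: cvg_snd.
have small e : 0 < e ->
    \forall p \near (\oo, (0 : R)^'+),
      [/\ (2 < p.1)%N, 0 < p.2 < 1 & C * (p.1%:R^-1 + p.2) <= e].
  (* With [1/n] and [eps] both below [d], the error is at most [C (d + d) = e]. *)
  move=> e0; pose d := e / (2 * C).
  have d0 : 0 < d by rewrite divr_gt0 // mulr_gt0.
  have eE : e = C * (d + d) by rewrite /d; field; lra.
  near=> p.
  have p1 : d^-1 < p.1%:R by near: p; exact: near1 (nbhs_infty_gtr _).
  have p2 : p.2 < d by near: p; exact: near2 (nbhs_right_lt d0).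
  split.
  - by near: p; exact: near1 (nbhs_infty_gt 2).
  - apply/andP; split; near: p; first exact: near2 (nbhs_right_gt 0).
    exact: near2 (nbhs_right_lt ltr01).
  - rewrite eE ler_pM2l //; apply: lerD; last exact: ltW.
    rewrite -[leRHS]invrK lef_pV2 ?posrE ?invr_gt0 //; first exact: ltW.
    by apply: lt_trans p1; rewrite invr_gt0.
split; apply/cvgrPdist_le => e e0; near=> p.
  have [n2 eps01 le] :
      [/\ (2 < p.1)%N, 0 < p.2 < 1 & C * (p.1%:R^-1 + p.2) <= e].
    by near: p; exact: small.
  by rewrite distrC; apply: le_trans le; have [] := vle _ _ n2 eps01.
have [n2 eps01 le] :
    [/\ (2 < p.1)%N, 0 < p.2 < 1 & C * (p.1%:R^-1 + p.2) <= e].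
  by near: p; exact: small.
rewrite sub0r normrN ger0_norm; last exact: bigmax_ge_id.
by apply: le_trans le; have [] := vle _ _ n2 eps01.
Unshelve. all: by end_near. Qed.

(** The estimates for a single network apply with [eta = 3/n + eps]. The bounds on [k] and [z] make
    both of them firms as soon as [n > 2]. *)
Lemma concentrates_at_hub (W : forall n : nat, R -> 'M[R]_n) (k z : nat) :
    (k < 3)%N -> (z < 3)%N ->
    (forall n eps, (2 < n)%N -> 0 < eps < 1 ->
      [/\ is_linkage (W n eps),
          forall i j, val j != k -> W n eps i j <= 3 / n%:R + eps
        & forall i j, val j = k -> val i != k -> val i != z ->
            1 - (3 / n%:R + eps) <= W n eps i j]) ->
  concentrates_at (fun n eps => influence alpha (W n eps)) k
    ((1 - alpha) / (2 - alpha)).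
Proof.
(* The hub estimate gives [2 (1/n + 3/n + eps)], which is at most [8 (1/n + eps)]. *)
move=> k3 z3 hW; apply: (@concentrates_at_bound _ _ _ 8) => // n eps n2 eps01.
have [Wl Wle Wge] := hW _ _ n2 eps01.
have [kn zn] : (k < n)%N /\ (z < n)%N.
  by split; [exact: leq_trans k3 _ | exact: leq_trans z3 _].
have n0 : (0 < n)%N by exact: leq_trans n2.
have nV : 0 <= n%:R^-1 :> R by rewrite invr_ge0.
have [e0 e1] := andP eps01.
split.
  rewrite /coord_at insubT.
  apply: le_trans (influence_hub halpha Wl n0 (eta := 3 / n%:R + eps)
    (k := Ordinal kn) (z := Ordinal zn) _ _ _) _; last by lra.
  - lra.
  - by move=> i j jk; apply: Wle.
  - by move=> i ik iz; apply: Wge.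
apply: bigmax_le => [|j jk]; first by nra.
apply: le_trans (norm_influence_small halpha Wl n0 (fun i => Wle i j jk)) _.
lra.
Qed.

End Concentration.

(** * The network with a dominant hub and a latent one *)

Definition two_hubs (R : realType) (n : nat) (eps : R) : 'M[R]_n :=
  \matrix_(i, j)
    match val i, val j with
    | 0, j => if (j < 2)%N then 0 else n.-2%:R^-1
    | _, 0 => 1 - eps
    | 1, 1 => 0
    | 1, _ => eps / n.-2%:R
    | _, 1 => eps
    | _, _ => 0
    end.

Section TwoHubs.
Variables (R : realType) (n : nat).
Hypothesis n_gt2 : (2 < n)%N.

(** Evaluates row sums: [c] is the total share spread evenly over the [n - 2] ordinary firms. *)
Lemma sum_split2 (f : nat -> R) (c : R) :
    (forall j, f j.+2 = c / n.-2%:R) ->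
  \sum_(j < n) f j = f 0 + f 1 + c.
Proof.
move=> fc; have : (0 < n.-2)%N by case: n n_gt2 => [|[|[]]].
case: n n_gt2 fc => [|[|m]] //= _ fc m0.
rewrite !big_ord_recl addrA; congr (_ + _).
under eq_bigr do rewrite fc.
by rewrite sumr_const card_ord -[LHS]mulr_natr divfK // pnatr_eq0 -lt0n.
Qed.

(** The value [eps = 1] is included because it describes the observed network. *)
Lemma two_hubs_linkage (eps : R) : 0 <= eps <= 1 -> is_linkage (two_hubs n eps).
Proof.
move=> /andP[e0 e1].
have nV : 0 <= n.-2%:R^-1 :> R by rewrite invr_ge0.
split.
- move=> [[|[|i]] hi] [[|[|j]] hj]; rewrite mxE //=; try lra; exact: mulr_ge0.
- by move=> [[|[|i]] hi]; rewrite mxE.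
- move=> [i hi]; under eq_bigr do rewrite mxE.
  case: i hi => [|[|i]] hi.
  + rewrite (@sum_split2 (fun j => if (j < 2)%N then 0 else n.-2%:R^-1) 1) /=.
      lra.
    by move=> j; rewrite div1r.
  + rewrite (@sum_split2 (fun j =>
      match j with 0 => 1 - eps | 1 => 0 | _ => eps / n.-2%:R end) eps) //=.
    by lra.
  + rewrite (@sum_split2 (fun j =>
      match j with 0 => 1 - eps | 1 => eps | _ => 0 end) 0) /=.
      lra.
    by move=> j; rewrite mul0r.
Qed.

(** Amounts to [n <= 3 (n - 2)], with equality at [n = 3]. *)
Lemma invr_pred2_le : n.-2%:R^-1 <= 3 / n%:R :> R.
Proof.
case: n n_gt2 => [|[|[|m]]] // _.
rewrite ler_pdivlMr ?ltr0n // mulrC ler_pdivrMr ?ltr0n // -natrM ler_nat /=.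
by lia.
Qed.

Lemma two_hubs_hub0 (eps : R) (i j : 'I_n) : 0 < eps < 1 ->
  (val j != 0 -> two_hubs n eps i j <= 3 / n%:R + eps) /\
  (val j = 0 -> val i != 0 -> 1 - (3 / n%:R + eps) <= two_hubs n eps i j).
Proof.
have nV : 0 <= n.-2%:R^-1 :> R by rewrite invr_ge0.
have := invr_pred2_le; set t := 3 / n%:R; set u := n.-2%:R^-1 in nV *.
move=> ut /andP[e0 e1]; rewrite mxE -/u.
case: i j => [[|[|i]] hi] [[|[|j]] hj] /=; split=> // *; try lra; nra.
Qed.

(** Firm 0 buys only from firms 2 and above, so it is the exceptional firm [z] for hub 1. *)
Lemma two_hubs_hub1 (eps : R) (i j : 'I_n) : 0 < eps ->
  (val j != 1 -> two_hubs n (1 : R) i j <= 3 / n%:R + eps) /\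
  (val j = 1 -> val i != 1 -> val i != 0 ->
    1 - (3 / n%:R + eps) <= two_hubs n (1 : R) i j).
Proof.
have nV : 0 <= n.-2%:R^-1 :> R by rewrite invr_ge0.
have := invr_pred2_le; set t := 3 / n%:R; set u := n.-2%:R^-1 in nV *.
move=> ut e0; rewrite mxE -/u.
by case: i j => [[|[|i]] hi] [[|[|j]] hj] /=; split=> // *; lra.
Qed.

(** * The observed network when the deliveries of firm 0 are missing *)

Definition without_hub0 (eps : R) : 'M[R]_n :=
  \matrix_(i, j) if val j == 0 then 0 else two_hubs n eps i j.

(** Firm 0 buys nothing from itself and loses nothing; every other firm loses [1 - eps]. *)
Lemma sum_without_hub0 (eps : R) (i : 'I_n) : 0 < eps < 1 ->
  \sum_j without_hub0 eps i j = if val i == 0 then 1 else eps.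
Proof.
move=> /andP[e0 e1]; have n0 : (0 < n)%N by exact: leq_trans n_gt2.
have [|_ _ /(_ i)] := @two_hubs_linkage eps; first by rewrite !ltW.
rewrite (bigD1 (Ordinal n0)) //= (bigD1 (Ordinal n0) (P := xpredT)) //=.
rewrite [without_hub0 _ _ _]mxE /= add0r mxE /=.
have -> : \sum_(j < n | j != Ordinal n0) without_hub0 eps i j =
    \sum_(j < n | j != Ordinal n0) two_hubs n eps i j.
  by apply: eq_bigr => j; rewrite -val_eqE mxE /= => /negPf ->.
by case: i => [[|[|i]] hi] /=; lra.
Qed.

(** Dividing the rows other than row 0 by their sum [eps] cancels every [eps] in them. *)
Lemma observed_without_hub0 (eps : R) : 0 < eps < 1 ->
  observed_linkage (without_hub0 eps) = two_hubs n 1.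
Proof.
move=> eps01; have [e0 e1] := andP eps01.
apply/matrixP => i j; rewrite mxE sum_without_hub0 // !mxE; set u := n.-2%:R^-1.
by case: i j => [[|[|i]] hi] [[|[|j]] hj] /=; field; lra.
Qed.

End TwoHubs.

Theorem theorem5p1 (R : realType) (alpha : R) (halpha : 0 < alpha < 1)
    (delta : R) (hdelta : 0 < delta) :
  exists (N : nat) (W : forall n : nat, R -> 'M[R]_n)
         (II : forall n : nat, R -> 'I_n -> R),
    [/\ forall (n : nat) (eps : R), (N <= n)%N -> 0 < eps < 1 ->
          is_linkage (W n eps) /\ (forall i : 'I_n, 0 < II n eps i),
        concentrates_at (fun n eps => influence alpha (W n eps)) 0
          ((1 - alpha) / (2 - alpha))
      & exists x : forall n : nat, R -> 'M[R]_n,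
          (forall (n : nat) (eps : R), (N <= n)%N -> 0 < eps < 1 ->
             is_observation (W n eps) (II n eps) (x n eps) /\
             missing_share_le delta (W n eps) (II n eps) (x n eps)) /\
          concentrates_at
            (fun n eps => influence alpha (observed_linkage (x n eps))) 1
            ((1 - alpha) / (2 - alpha))].
(* The bound 3 ensures that ordinary firms exist; the other bound gives [delta * n >= 1], so one
   firm may have missing data. *)
exists (maxn 3 (Num.bound delta^-1)), (fun n eps => two_hubs n eps).
(* With unit input totals, amounts and shares coincide. *)
exists (fun _ _ _ => 1).
have small n : (maxn 3 (Num.bound delta^-1) <= n)%N ->
    (2 < n)%N /\ 1 <= delta * n%:R.
  rewrite geq_max => /andP[n2 nd]; split=> //.
  rewrite mulrC -ler_pdivrMr // div1r.
  apply: ltW; apply: (lt_le_trans (archi_boundP _)); last by rewrite ler_nat.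
  by rewrite invr_ge0 ltW.
split.
- move=> n eps /small[n2 _] /andP[e0 e1]; split=> //.
  by apply: two_hubs_linkage => //; rewrite !ltW.
(* Taking [z = k = 0] means that no firm besides the hub is exceptional. *)
- apply: (@concentrates_at_hub _ _ halpha _ 0 0) => // n eps n2 eps01; split.
  + by have [e0 e1] := andP eps01; apply: two_hubs_linkage => //; rewrite !ltW.
  + by move=> i j; have [] := two_hubs_hub0 n2 i j eps01.
  + by move=> i j j0 i0 _; have [_] := two_hubs_hub0 n2 i j eps01; apply.
exists (fun n eps => without_hub0 n eps); split.
  move=> n eps /small[n2 nd] eps01; have [e0 e1] := andP eps01.
  have [W0 _ _] : is_linkage (two_hubs n eps).
    by apply: two_hubs_linkage => //; rewrite !ltW.
  split; first split.
  + move=> i j; rewrite mulr1 [without_hub0 _ _ _ _]mxE.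
    by case: ifP => _; rewrite ?lexx W0.
  + by move=> i; rewrite sum_without_hub0 //; case: ifP.
  + have n0 : (0 < n)%N by exact: leq_trans n2.
    exists [set Ordinal n0]%SET; first by rewrite cards1.
    move=> i j; rewrite inE -val_eqE /= => /negPf j0.
    by rewrite mxE j0 mulr1.
apply: (@concentrates_at_hub _ _ halpha _ 1 0) => // n eps n2 eps01.
have [e0 _] := andP eps01; rewrite observed_without_hub0 //; split.
- by apply: two_hubs_linkage => //; rewrite lexx ler01.
- by move=> i j; have [] := two_hubs_hub1 n2 i j e0.
- by move=> i j j1 i1 i0; have [_] := two_hubs_hub1 n2 i j e0; apply.
Qed.
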